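(* Let $A$ be a subset of an abelian group $\Gamma$ such that $A$ does not satisfy the following condition: every finite subset $X$ of $\Gamma$ with $\sum_{g\in X}g\in A$ contains a subset $Y$ of size $y\leq 2$ such that $\langle yY\rangle\cap A\neq\emptyset$. Then for every positive integer $t$, there is a planar graph $G_{\Gamma,A,t}$ with a $\Gamma$-labelling $\gamma$ such that for the set $\mathcal{O}$ of cycles of $G_{\Gamma,A,t}$ with $\gamma$-values in $A$, there are no three vertex-disjoint cycles in $\mathcal{O}$ and there is no hitting set for $\mathcal{O}$ of size at most $t$.
   Context: All graphs are undirected and simple. $\langle S\rangle$ denotes the subgroup generated by $S$, with $\langle\emptyset\rangle=\{0\}$; $yY=\{yg: g\in Y\}$. A $\Gamma$-labelling of $G$ is a function $\gamma\colon E(G)\to\Gamma$; the $\gamma$-value of a subgraph $H$ is $\gamma(H)=\sum_{e\in E(H)}\gamma(e)$. A hitting set for $\mathcal{O}$ is a set of vertices meeting every cycle in $\mathcal{O}$. *)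

(* Defs.v *)
From mathcomp Require Import all_boot all_order all_algebra finmap.
From mathcomp Require Import all_classical all_reals all_analysis.
Set Implicit Arguments.
Unset Strict Implicit.
Unset Printing Implicit Defensive.
Import GRing.Theory numFieldNormedType.Exports.
Local Open Scope classical_set_scope.
Local Open Scope ring_scope.

Section Groups.
Variable Gamma : zmodType.

Definition is_subgroup (H : set Gamma) : Prop :=
  H 0 /\ (forall x y, H x -> H y -> H (x - y)).

Definition subgroup_gen (S : set Gamma) : set Gamma := smallest is_subgroup S.

(* The set yY, where y = |Y|. *)
Definition card_scale (Y : {fset Gamma}) : set Gamma :=
  [set g *+ #|` Y| | g in [set` Y]].

Definition two_subset_condition (A : set Gamma) : Prop :=
  forall X : {fset Gamma}, A (\sum_(g <- X) g) ->
  exists Y : {fset Gamma},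
    [/\ (Y `<=` X)%fset, (#|` Y| <= 2)%N
      & subgroup_gen (card_scale Y) `&` A !=set0].

End Groups.

Record sgraph := SGraph {
  vertex :> finType;
  adj : rel vertex;
  adj_sym : symmetric adj;
  adj_irr : irreflexive adj
}.

Definition edge_set (G : sgraph) : {set {set G}} :=
  [set [set p.1; p.2] | p : G * G & adj p.1 p.2]%SET.

Definition edge (G : sgraph) : finType := {e : {set G} | e \in edge_set G}.

Record subgraph (G : sgraph) := Subgraph {
  subV : {set G};
  subE : {set {set G}};
  subE_edges : subE \subset edge_set G;
  subE_ends : forall e : {set G}, e \in subE -> e \subset subV
}.

(* The vertices of a cycle listed in cyclic order; the length is at least 3
   because the graph is simple. *)
Definition is_cycle (G : sgraph) (H : subgraph G) : Prop :=
  exists c : seq G,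
    [/\ ucycle (@adj G) c, (2 < size c)%N,
        subV H = [set x in c]%SET
      & subE H = [set [set x; next c x] | x in c]%SET].

Definition labelling (G : sgraph) (Gamma : zmodType) : Type := edge G -> Gamma.

Definition value (G : sgraph) (Gamma : zmodType) (gamma : labelling G Gamma)
    (H : subgraph G) : Gamma :=
  \sum_(e : edge G | val e \in subE H) gamma e.

Definition cycles_in (G : sgraph) (Gamma : zmodType) (gamma : labelling G Gamma)
    (A : set Gamma) : set (subgraph G) :=
  [set H | is_cycle H /\ A (value gamma H)].

Definition vertex_disjoint (G : sgraph) (H K : subgraph G) : Prop :=
  (subV H :&: subV K)%SET = finset.set0.

Definition hitting_set (G : sgraph) (O : set (subgraph G)) (S : {set G}) : Prop :=
  forall H, O H -> exists2 v, v \in S & v \in subV H.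

(* Drawing in the plane R^2: each edge is a simple arc joining its two ends,
   and the interior of an edge contains no vertex and no point of any other
   edge. *)
Record plane_drawing (R : realType) (G : sgraph)
    (p : G -> R * R) (a : edge G -> R -> R * R) : Prop := PlaneDrawing {
  drawing_inj : injective p;
  drawing_cont : forall e, {within `[0, 1], continuous (a e)};
  drawing_arc : forall e, {in `[0, 1] &, injective (a e)};
  drawing_ends : forall e, [set a e 0; a e 1] = p @` [set` val e];
  drawing_vertex : forall e s v, s \in `]0, 1[ -> a e s <> p v;
  drawing_edge : forall e e' s s', e <> e' ->
    s \in `]0, 1[ -> s' \in `[0, 1] -> a e s <> a e' s'
}.

Definition planar (R : realType) (G : sgraph) : Prop :=
  exists p a, @plane_drawing R G p a.

(* Main.v *)
Require Import Defs.
From mathcomp Require Import all_boot all_order all_algebra finmap.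
From mathcomp Require Import all_classical all_reals all_analysis.
From mathcomp Require Import zify lra.
(** Let [X] witness the failure of the condition, and pick a minimal subset [Z]
    of [X] that has an integer combination in [A]. If [Z] has at least three
    elements, splitting the combination gives [g1 + g2 + g3] in [A] such that
    cycles with values in [A] must use all three labels. In a large square grid
    put these labels on three consecutive segments of the top row: two disjoint
    cycles would then contain disjoint paths with interleaved ends in the top
    row. If [Z] has two elements, suitable multiples satisfy [g + h] in [A] and
    [p g + q h] in [A] only for odd [p] and nonzero [q]. Put [g] on the edges
    crossed by a vertical ray from an inner face up to the outer face and [h] on
    the top row to its left: a cycle with value in [A] surrounds the inner face
    and touches the top row, so no two are disjoint. In both cases a cycle that
    follows two rows and rises to the top row in one or three places avoids any
    given small vertex set. *)
Set Implicit Arguments.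
Unset Strict Implicit.
Unset Printing Implicit Defensive.
Import Order.TTheory GRing.Theory Num.Theory numFieldNormedType.Exports.

(** * Walks in the grid and crossing parity *)

Definition steps (T : Type) (x : T) (p : seq T) : seq (T * T) := pairmap pair x p.

Lemma steps_cat (T : Type) (x : T) (p q : seq T) :
  steps x (p ++ q) = steps x p ++ steps (last x p) q.
Proof. exact: pairmap_cat. Qed.

Lemma steps_mem (T : eqType) (e : rel T) (x : T) (p : seq T) (u : T * T) :
  path e x p -> u \in steps x p -> [/\ e u.1 u.2, u.1 \in x :: p & u.2 \in x :: p].
Proof.
elim: p x => [|y p IHp] x //= /andP[exy pathp].
rewrite in_cons => /orP[/eqP->|/(IHp _ pathp)[euv u1 u2]].
  by split; rewrite //= !in_cons eqxx ?orbT.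
by split; [exact: euv | apply/orP; right | rewrite in_cons u2 orbT].
Qed.

Lemma addb_steps_telescope (T : Type) (f : T -> bool) (x : T) (p : seq T) :
  \big[addb/false]_(u <- steps x p) (f u.1 (+) f u.2) = f x (+) f (last x p).
Proof.
elim: p x => [|y p IHp] x; first by rewrite big_nil /= addbb.
by rewrite /= big_cons IHp /=; case: (f x); case: (f y); case: (f (last y p)).
Qed.

Lemma cycle_walk (T : eqType) (e : rel T) (c : seq T) (x y : T) :
  cycle e c -> x \in c -> y \in c ->
  exists p, [/\ path e x p, last x p = y & {subset x :: p <= c}].
Proof.
move=> cc xc; have [i q rotc] := rot_to xc.
have qc : x :: q =i c by move=> z; rewrite -rotc mem_rot.
move: cc; rewrite -(rot_cycle i) rotc /= rcons_path => /andP[pq _].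
rewrite -qc => yq; move: qc pq {rotc}.
case/splitPl: yq => p1 p2 lastp qc pq.
exists p1; split=> //; first by move: pq; rewrite cat_path => /andP[].
by move=> z zp; rewrite -qc -cat_cons mem_cat zp.
Qed.

Definition grid_step : rel (nat * nat) := fun a b =>
  (a.2 == b.2) && (b.1 == a.1.+1) || (a.1 == b.1) && (b.2 == a.2.+1).

Definition grid_adj : rel (nat * nat) := fun a b => grid_step a b || grid_step b a.

(* Whether the edge [u] crosses the vertical ray that starts just right of [v]
   and goes up: rows are numbered downwards from the top row [0]. *)
Definition above (v : nat * nat) (u : (nat * nat) * (nat * nat)) : bool :=
  ((u.1.1 <= v.1) != (u.2.1 <= v.1)) && (u.1.2 < v.2).

(* The walk is closed up by an arc above the top row, which the ray from [v]
   meets exactly when the last two terms differ. *)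
Definition ray_parity (x : nat * nat) (p : seq (nat * nat)) (v : nat * nat) : bool :=
  \big[addb/false]_(u <- steps x p) above v u (+)
    ((x.1 <= v.1) (+) ((last x p).1 <= v.1)).

(** Lowering the start of the ray by one row adds a single crossed edge, the one leaving [v] to the
    right, and the walk avoids [v]. *)
Lemma ray_parity_down (x v : nat * nat) (p : seq (nat * nat)) :
  path grid_adj x p -> v \notin x :: p ->
  ray_parity x p (v.1, v.2.+1) = ray_parity x p v.
Proof.
move=> pathp vp; congr (_ (+) _); apply: eq_big_seq => u /(steps_mem pathp)[auv u1 u2].
have n1 : u.1 != v by apply: contraNneq vp => <-.
have n2 : u.2 != v by apply: contraNneq vp => <-.
move: auv n1 n2; rewrite /above /grid_adj /grid_step.
case: u v {vp u1 u2} => [[a1 a2] [b1 b2]] [v1 v2] /=; rewrite !xpair_eqE; lia.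
Qed.

(** For a horizontal step the two rays bound a strip around the column of [w]. A closed curve enters
    and leaves this strip equally often, and it cannot do so through [w]. A vertical step is
    [ray_parity_down]. *)
Lemma ray_parity_step (x : nat * nat) (p : seq (nat * nat)) (v w : nat * nat) :
  path grid_adj x p -> x.2 = 0 -> (last x p).2 = 0 ->
  v \notin x :: p -> w \notin x :: p -> grid_step v w ->
  ray_parity x p v = ray_parity x p w.
Proof.
move=> pathp x0 l0 vp wp; case/orP=> /andP[/eqP e2 /eqP e1].
- have /(congr1 (addb (ray_parity x p w))) : ray_parity x p v (+) ray_parity x p w = false.
    rewrite /ray_parity addbACA -big_split /=.
    (* [f] marks the part of the strip above [w]. An edge of the walk crosses exactly one of the two
       rays when it changes [f], so the sum telescopes to the two ends; these lie in row 0, where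
       the arc terms cancel it. *)
    pose f (a : nat * nat) := (a.1 == w.1) && (a.2 < w.2).
    have -> : \big[addb/false]_(u <- steps x p) (above v u (+) above w u) =
              \big[addb/false]_(u <- steps x p) (f u.1 (+) f u.2).
      apply: eq_big_seq => u /(steps_mem pathp)[auv u1 u2].
      have n1 : u.1 != w by apply: contraNneq wp => <-.
      have n2 : u.2 != w by apply: contraNneq wp => <-.
      move: auv n1 n2; rewrite /f /above /grid_adj /grid_step; clear -e1 e2.
      case: u v w e1 e2 => [[a1 a2] [b1 b2]] [v1 v2] [w1 w2] /= ? ?; subst.
      rewrite !xpair_eqE; lia.
    rewrite addb_steps_telescope /f.
    have n1 : x != w by apply: contraNneq wp => <-; rewrite mem_head.
    have n2 : last x p != w by apply: contraNneq wp => <-; rewrite mem_last.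
    move: n1 n2 x0 l0; case: (last x p) => [l1 l2]; clear -e1 e2.
    case: x v w e1 e2 => [x1 x2] [v1 v2] [w1 w2] /= ? ?; subst.
    rewrite !xpair_eqE; lia.
  by rewrite addbF addbCA addbb addbF.
- rewrite -(ray_parity_down pathp vp); congr ray_parity.
  by case: w e1 e2 {wp} => w1 w2 /= -> ->.
Qed.

(** A discrete Jordan curve argument: a walk disjoint from the closed-up curve stays on one side of
    it. *)
Lemma ray_parity_walk (x z : nat * nat) (p q : seq (nat * nat)) :
  path grid_adj x p -> x.2 = 0 -> (last x p).2 = 0 -> path grid_adj z q ->
  {in z :: q, forall v, v \notin x :: p} ->
  {in z :: q, forall v, ray_parity x p v = ray_parity x p z}.
Proof.
move=> pathp x0 l0; elim: q z => [|y q IHq] z /=.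
  by move=> _ _ v; rewrite inE => /eqP->.
move=> /andP[zy pathq] dis v; rewrite inE => /predU1P[->//|vq].
have dis' : {in y :: q, forall u, u \notin x :: p}.
  by move=> u uq; apply: dis; rewrite inE uq orbT.
rewrite (IHq y) //.
have nz : z \notin x :: p by apply: dis; rewrite mem_head.
have ny : y \notin x :: p by apply: dis'; rewrite mem_head.
case/orP: zy => st; [apply/esym|]; exact: (ray_parity_step pathp).
Qed.

Lemma ray_parity_top (x v : nat * nat) (p : seq (nat * nat)) : v.2 = 0 ->
  ray_parity x p v = (x.1 <= v.1) (+) ((last x p).1 <= v.1).
Proof.
move=> v0; rewrite /ray_parity big1 ?addFb // => u _.
by rewrite /above v0 ltn0 andbF.
Qed.

(** The end of [q] lies under the closing arc of [p] and its start [z] does not, so the parities at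
    the two ends of [q] differ although [q] avoids [p]. *)
Lemma no_interleaved_walks (x z : nat * nat) (p q : seq (nat * nat)) :
  path grid_adj x p -> path grid_adj z q ->
  x.2 = 0 -> (last x p).2 = 0 -> z.2 = 0 -> (last z q).2 = 0 ->
  {in z :: q, forall v, v \notin x :: p} ->
  z.1 < x.1 -> x.1 < (last z q).1 -> (last z q).1 < (last x p).1 -> False.
Proof.
move=> pathp pathq x0 l0 z0 m0 dis lt1 lt2 lt3.
have := ray_parity_walk pathp x0 l0 pathq dis (mem_last z q).
rewrite !ray_parity_top // (ltnW lt2) (leqNgt (last x p).1) lt3 leqNgt lt1.
by rewrite leqNgt (ltn_trans lt1 (ltn_trans lt2 lt3)).
Qed.

(** Climb the ray from [(col, row)]. As long as neither walk is met, both parities persist, and in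
    row 0 both are false. The first vertex met lies on one walk and inside the other; but the walk
    through it reaches row 0, which is outside. *)
Lemma no_nested_closed_walks (x z : nat * nat) (p q : seq (nat * nat)) (col row : nat) :
  path grid_adj x p -> path grid_adj z q ->
  x.2 = 0 -> z.2 = 0 -> last x p = x -> last z q = z ->
  {in z :: q, forall v, v \notin x :: p} ->
  ray_parity x p (col, row) -> ray_parity z q (col, row) -> False.
Proof.
move=> pathp pathq x0 z0 lx lz dis.
have dis' : {in x :: p, forall v, v \notin z :: q}.
  by move=> v vp; apply/negP => /dis; rewrite vp.
elim: row => [|row IHrow]; first by rewrite ray_parity_top // lx addbb.
have [vp|vp] := boolP ((col, row) \in x :: p).
  move=> _; rewrite (ray_parity_down (v := (col, row))) ?dis' //.
  by rewrite (ray_parity_walk pathq _ _ pathp) ?lz // ray_parity_top // lz addbb.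
have [vq|vq] := boolP ((col, row) \in z :: q).
  rewrite (ray_parity_down (v := (col, row))) //.
  by rewrite (ray_parity_walk pathp _ _ pathq) ?lx // ray_parity_top // lx addbb.
rewrite (ray_parity_down (v := (col, row)) pathp) //.
by rewrite (ray_parity_down (v := (col, row)) pathq).
Qed.

(** * Group theory *)

Lemma subgroup_mulz (Gamma : zmodType) (H : set Gamma) (x : Gamma) (n : int) :
  is_subgroup H -> H x -> H (x *~ n)%R.
Proof.
case=> H0 HB Hx.
have HN y : H y -> H (- y)%R by move=> Hy; rewrite -sub0r; apply: HB.
have Hn k : H (x *+ k)%R.
  elim: k => [|k IHk]; first by rewrite mulr0n.
  by rewrite mulrS -[(x *+ k)%R]opprK; apply: HB => //; apply: HN.
by case: n => k; [exact: Hn | rewrite NegzE mulrNz; apply: HN; exact: Hn].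
Qed.

Lemma subgroup_add (Gamma : zmodType) (H : set Gamma) (x y : Gamma) :
  is_subgroup H -> H x -> H y -> H (x + y)%R.
Proof.
move=> sH Hx Hy; rewrite -[y]opprK; apply: sH.2 => //.
by rewrite -sub0r; apply: sH.2 => //; exact: sH.1.
Qed.

Section Witness.
Variables (Gamma : zmodType) (A : set Gamma) (X : {fset Gamma}).
Hypothesis Xbad : forall Y : {fset Gamma}, (Y `<=` X)%fset -> (#|` Y| <= 2)%N ->
  ~ (subgroup_gen (card_scale Y) `&` A !=set0)%classic.

Lemma bad0 : ~ A 0%R.
Proof.
move=> A0; apply: (@Xbad fset0); rewrite ?fsub0set ?cardfs0 //.
by exists 0%R; split=> // H [[]].
Qed.

Lemma bad1 (g : Gamma) (n : int) : g \in X -> ~ A (g *~ n)%R.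
Proof.
move=> gX An; apply: (@Xbad [fset g]%fset); rewrite ?fsub1set ?cardfs1 //.
exists (g *~ n)%R; split=> // H [sH subH]; apply: subgroup_mulz => //.
by apply: subH; exists g; rewrite /= ?inE ?cardfs1.
Qed.

(** For a pair [Y] the set [card_scale Y] consists of the doubles, so only even coefficients are
    excluded. This is the source of the parity condition in the nested case. *)
Lemma bad2 (g h : Gamma) (n m : int) : g \in X -> h \in X -> g != h ->
  ~ A (g *~ (2 * n) + h *~ (2 * m))%R.
Proof.
move=> gX hX gh An; apply: (@Xbad [fset g; h]%fset).
- by apply/fsubsetP => x; rewrite !inE => /orP[]/eqP->.
- by rewrite cardfs2 gh.
exists (g *~ (2 * n) + h *~ (2 * m))%R; split=> // H [sH subH].
rewrite !mulrzA; apply: subgroup_add => //; apply: subgroup_mulz => //; apply: subH.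
  by exists g; rewrite /= ?inE ?eqxx // cardfs2 gh.
by exists h; rewrite /= ?inE ?eqxx ?orbT // cardfs2 gh.
Qed.

(** By [bad0] and [bad1] a minimal [Z] has at least two elements. With exactly two the first
    alternative holds; with more, all but two are bundled into one summand. *)
Lemma nested_or_triple : A (\sum_(g <- X) g)%R ->
  (exists g h : Gamma, A (g + h)%R /\
     forall p q : nat, A (g *+ p + h *+ q)%R -> odd p && (0 < q)) \/
  (exists g1 g2 g3 : Gamma, A (g1 + g2 + g3)%R /\
     forall p q r : nat, A (g1 *+ p + g2 *+ q + g3 *+ r)%R -> [&& 0 < p, 0 < q & 0 < r]).
Proof.
move=> AX.
pose zcomb (Z : {fset Gamma}) (n : Gamma -> int) : Gamma := (\sum_(g <- Z) g *~ n g)%R.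
pose attains k :=
  exists (Z : {fset Gamma}) n, [/\ (Z `<=` X)%fset, #|` Z| = k & A (zcomb Z n)].
have ex : exists k, `[< attains k >].
  exists #|` X|; apply/asboolP; exists X, (fun=> 1%R); split=> //.
case: (ex_minnP ex) => k /asboolP[Z [n [ZX Zk AZ]]] mink {ex}.
have small Z' n' : (Z' `<=` X)%fset -> #|` Z'| < k -> ~ A (zcomb Z' n').
  move=> Z'X lt AZ'; have : k <= #|` Z'| by apply: mink; apply/asboolP; exists Z', n'.
  by rewrite leqNgt lt.
have [Z0|[a aZ]] := fset_0Vmem Z.
  by case: bad0; move: AZ; rewrite /zcomb Z0 big_seq_fset0.
have aX : a \in X by exact: (fsubsetP ZX).
pose Z1 := (Z `\ a)%fset.
have Zcomb1 n' : zcomb Z n' = (a *~ n' a + zcomb Z1 n')%R.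
  by rewrite /zcomb (big_fsetD1 a).
have k1 : k = #|` Z1|.+1 by rewrite -Zk (cardfsD1 a) aZ.
have Z1X : (Z1 `<=` X)%fset by rewrite (fsubset_trans _ ZX) // fsubD1set.
have [Z10|[b bZ]] := fset_0Vmem Z1.
  by case: (@bad1 a (n a)) => //; move: AZ; rewrite Zcomb1 /zcomb Z10 big_seq_fset0 addr0.
have bX : b \in X by exact: (fsubsetP Z1X).
have ab : a != b by move: bZ; rewrite !inE eq_sym => /andP[].
pose Z2 := (Z1 `\ b)%fset.
have Zcomb2 n' : zcomb Z n' = (a *~ n' a + (b *~ n' b + zcomb Z2 n'))%R.
  by rewrite Zcomb1 /zcomb (big_fsetD1 b).
have k2 : k = #|` Z2|.+2 by rewrite k1 (cardfsD1 b) bZ.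
have Z2X : (Z2 `<=` X)%fset by rewrite (fsubset_trans _ Z1X) // fsubD1set.
have mulC (g : Gamma) (i : int) (p : nat) : (g *~ i *+ p = g *~ (i * p%:Z))%R.
  by rewrite mulrzA.
have mulz0 (g : Gamma) : (g *~ 0 = 0)%R by rewrite mulr0z.
have [Z20|[c cZ]] := fset_0Vmem Z2; [left | right].
- move: AZ; rewrite Zcomb2 /zcomb Z20 big_seq_fset0 addr0.
  move: (n a) (n b) => i j Aij {small Zcomb1 Zcomb2 Z2X k2 Z20 Z2 n mink}.
  have nb g h : g \in X -> h \in X -> g != h ->
      forall x y : int, ~~ odd `|x| -> ~~ odd `|y| -> ~ A (g *~ x + h *~ y)%R.
    have even2 (x : int) : ~~ odd `|x| -> exists y, x = (2 * y)%R.
      by rewrite -dvdn2 => /(@dvdzP 2 x)[y ->]; exists y; rewrite mulrC.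
    by move=> gX hX gh x y /even2[x' ->] /even2[y' ->]; exact: bad2.
  have single g h (x y : int) (p q : nat) : g \in X ->
      A (g *~ (x * p%:Z) + h *~ (y * q%:Z))%R -> 0 < q.
    by move=> gX; case: q => //; rewrite mulr0 mulz0 addr0 => /bad1; case.
  (* Elements of A with coefficients of different parities are preferred: the
     even coefficient then stays even in every multiple, and if there are none,
     an even multiple of one summand cannot meet an odd one of the other. *)
  have [[g [h [x [y [gX hX gh [ox ey Axy]]]]]]|nomix] := pselect (exists g h (x y : int),
    [/\ g \in X, h \in X, g != h &
      [/\ odd `|x|, ~~ odd `|y| & A (g *~ x + h *~ y)%R]]).
    exists (g *~ x)%R, (h *~ y)%R; split=> // p q; rewrite !mulC => Apq.
    rewrite (single _ _ _ _ _ _ gX Apq) andbT; apply/negPn/negP => ep.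
    case: (nb g h gX hX gh _ _ _ _ Apq); rewrite abszM oddM negb_and ?ep ?orbT //.
    by rewrite ey.
  have oi : odd `|i|.
    apply/negPn/negP => ei; case oj: (odd `|j|); last first.
      by case: (nb a b aX bX ab i j); rewrite ?oj.
    by case: nomix; exists b, a, j, i; split; rewrite // 1?eq_sym // addrC.
  have oj : odd `|j|.
    by apply/negPn/negP => ej; case: nomix; exists a, b, i, j.
  exists (a *~ i)%R, (b *~ j)%R; split=> // p q; rewrite !mulC => Apq.
  rewrite (single _ _ _ _ _ _ aX Apq) andbT; apply/negPn/negP => ep.
  have ep' : ~~ odd `|(i * p%:Z)%R| by rewrite abszM oddM negb_and ep orbT.
  case oq: (odd `|(j * q%:Z)%R|); last by apply: (nb a b aX bX ab _ _ ep' _ Apq); rewrite oq.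
  case: nomix; exists b, a, (j * q%:Z)%R, (i * p%:Z)%R.
  by split; rewrite // 1?eq_sym // addrC.
- exists (a *~ n a)%R, (b *~ n b)%R, (zcomb Z2 n); split.
    by move: AZ; rewrite Zcomb2 addrA.
  move=> p q r.
  have mulZ2 : (zcomb Z2 n *+ r)%R = zcomb Z2 (fun g => n g * r%:Z)%R.
    by rewrite /zcomb -sumrMnl; apply: eq_bigr => g _; rewrite mulC.
  rewrite mulZ2 !mulC => Apqr.
  have aZ2 : a \notin Z2 by rewrite !inE eqxx andbF.
  have bZ2 : b \notin Z2 by rewrite !inE eqxx.
  (* The third element [c] makes [k] at least 3. Whichever of [p], [q], [r] vanishes, the
     combination is supported on fewer than [k] elements, against minimality. *)
  have card_ab : #|` [fset a; b]%fset| < k.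
    by rewrite cardfs2 ab k2 (cardfsD1 c) cZ.
  have abX : ([fset a; b] `<=` X)%fset.
    by apply/fsubsetP => x; rewrite !inE => /orP[]/eqP->.
  have card_b : #|` (b |` Z2)%fset| < k by rewrite cardfsU1 bZ2 k2.
  have bX2 : ((b |` Z2) `<=` X)%fset by rewrite fsubUset fsub1set bX.
  have card_a : #|` (a |` Z2)%fset| < k by rewrite cardfsU1 aZ2 k2.
  have aX2 : ((a |` Z2) `<=` X)%fset by rewrite fsubUset fsub1set aX.
  apply/and3P; split; rewrite lt0n; apply/eqP => E.
  + case: (small _ (fun g => n g * if g == b then q%:Z else r%:Z)%R bX2 card_b).
    rewrite /zcomb big_fsetU1 //= eqxx (eq_big_seq (fun g => g *~ (n g * r%:Z))%R).
      by move: Apqr; rewrite E mulr0 mulz0 add0r.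
    by move=> g gZ; case: eqP gZ bZ2 => // -> ->.
  + case: (small _ (fun g => n g * if g == a then p%:Z else r%:Z)%R aX2 card_a).
    rewrite /zcomb big_fsetU1 //= eqxx (eq_big_seq (fun g => g *~ (n g * r%:Z))%R).
      by move: Apqr; rewrite E mulr0 mulz0 addr0.
    by move=> g gZ; case: eqP gZ aZ2 => // -> ->.
  + case: (small _ (fun g => n g * if g == a then p%:Z else q%:Z)%R abX card_ab).
    rewrite /zcomb big_fsetU1 ?inE //= big_seq_fset1 eqxx eq_sym (negPf ab).
    by move: Apqr; rewrite E /zcomb big1 ?addr0 // => g _; rewrite mulr0 mulz0.
Qed.

End Witness.

(** * The plane grid *)

Lemma grid_adj_sym : symmetric grid_adj.
Proof. by move=> a b; rewrite /grid_adj orbC. Qed.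

Lemma grid_adj_irr : irreflexive grid_adj.
Proof. by case=> x y; rewrite /grid_adj /grid_step /=; lia. Qed.

Definition coord (W H : nat) (v : 'I_W * 'I_H) : nat * nat := (v.1 : nat, v.2 : nat).

Lemma coord_inj (W H : nat) : injective (@coord W H).
Proof. by move=> [i j] [i' j'] [/ord_inj-> /ord_inj->]. Qed.

Lemma coord_adj_sym (W H : nat) : symmetric (relpre (@coord W H) grid_adj).
Proof. by move=> a b; exact: grid_adj_sym. Qed.

Lemma coord_adj_irr (W H : nat) : irreflexive (relpre (@coord W H) grid_adj).
Proof. by move=> a; exact: grid_adj_irr. Qed.

Definition grid (W H : nat) : sgraph :=
  @SGraph ('I_W * 'I_H)%type _ (@coord_adj_sym W H) (@coord_adj_irr W H).

Lemma grid_edge_ends (W H : nat) (e : edge (grid W H)) :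
  exists p : grid W H * grid W H,
    val e = [set p.1; p.2]%SET /\ grid_step (coord p.1) (coord p.2).
Proof.
case: e => B /= /imsetP[[u v]]; rewrite inE /= => /orP[uv|vu] ->.
  by exists (u, v).
by exists (v, u); rewrite finset.setUC.
Qed.

(** Edges are drawn as unit segments from a base point [b e] in direction [d e]. An interior point
    has exactly one non-integer coordinate, which reveals the direction, and rounding down recovers
    the base point. *)
Lemma grid_planar (R : realType) (W H : nat) : planar R (grid W H).
Proof.
have [ends endsP] := choice (@grid_edge_ends W H).
pose b e := coord (ends e).1.
pose d e : nat * nat := ((coord (ends e).2).1 - (b e).1, (coord (ends e).2).2 - (b e).2).
have endE e : coord (ends e).2 = ((b e).1 + (d e).1, (b e).2 + (d e).2).
  have [_] := endsP e; rewrite /grid_step /d /b.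
  by case: (coord _) => x y; case: (coord _) => x' y' /= *; congr pair; lia.
have dP e : d e = (1, 0) \/ d e = (0, 1).
  have [_] := endsP e; rewrite /grid_step endE -/(b e).
  case: (d e) => x y /=; case/orP=> /andP[/eqP E1 /eqP E2]; [left | right];
    congr pair; lia.
have bd_inj e e' : b e = b e' -> d e = d e' -> e = e'.
  move=> bb dd; apply: val_inj; rewrite (endsP e).1 (endsP e').1.
  have -> : (ends e).1 = (ends e').1 by apply: coord_inj.
  by have -> : (ends e).2 = (ends e').2 by apply: coord_inj; rewrite !endE bb dd.
have bE e : coord (ends e).1 = b e by [].
clearbody d; clearbody b.
pose P (v : nat * nat) : R * R := (v.1%:R, v.2%:R)%R.
pose a e s : R * R := ((b e).1%:R + (d e).1%:R * s, (b e).2%:R + (d e).2%:R * s)%R.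
have Pinj : injective P.
  by move=> [x y] [x' y'] [] /eqP + /eqP; rewrite !eqr_nat => /eqP-> /eqP->.
(* The parameter [s'] ranges over the closed interval because the second point may be an end of its
   edge. *)
have near_nat (m n : nat) (s s' : R) : (0 < s < 1)%R -> (0 <= s' <= 1)%R ->
    (m%:R + s = n%:R + s')%R -> m = n.
  move=> s01 s'01 E; apply/eqP; rewrite eqn_leq.
  by apply/andP; split; rewrite -ltnS -(ltr_nat R) -natr1; lra.
have no_nat (m n : nat) (s : R) : (0 < s < 1)%R -> (m%:R + s = n%:R)%R -> False.
  move=> s01 E; have : m = n by apply: (@near_nat _ _ s 0%R) => //; [lra | rewrite addr0].
  by move=> mn; move: E; rewrite mn; lra.
exists (P \o @coord W H), a; split.
- exact: inj_comp Pinj (@coord_inj W H).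
- move=> e; apply: (@continuous_subspaceT _ _ _ (a e)) => s.
  have c (m n : nat) : ((m%:R + n%:R * u)%R @[u --> s] --> (m%:R + n%:R * s :> R)%R)%classic.
    by apply: cvgD; [exact: cvg_cst | apply: cvgM; [exact: cvg_cst | exact: cvg_id]].
  exact: (cvg_pair (c _ _) (c _ _)).
- move=> e s s' _ _ [] E1 E2; case: (dP e) E1 E2 => -> /=; lra.
- move=> e.
  have -> : a e 0%R = P (coord (ends e).1) by rewrite /a bE /P !mulr0 !addr0.
  have -> : a e 1%R = P (coord (ends e).2) by rewrite /a endE /P /= !mulr1 !natrD.
  apply/seteqP; split=> x /=.
    by case=> ->; [exists (ends e).1 | exists (ends e).2];
      rewrite //= (endsP e).1 !inE eqxx ?orbT.
  by case=> v /=; rewrite (endsP e).1 !inE => /orP[]/eqP-> <-; [left | right].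
- move=> e s v; rewrite in_itv /= => s01 [] E1 E2.
  by case: (dP e) E1 E2 => -> /=; rewrite mul0r mul1r ?addr0 => E1 E2;
    [apply: (no_nat _ _ _ s01 E1) | apply: (no_nat _ _ _ s01 E2)].
- move=> e e' s s' ne; rewrite !in_itv /= => s01 s'01 [] E1 E2; apply: ne.
  move: E1 E2; case: (dP e) (dP e') => de [] de';
    rewrite de de' /= !(mul0r, mul1r, addr0) => E1 E2.
  + apply: bd_inj; last by rewrite de de'.
    by apply: Pinj; congr pair => //; congr (_%:R)%R; apply: near_nat E1.
  + by case: (no_nat _ _ _ s01 E1).
  + by case: (no_nat _ _ _ s01 E2).
  + apply: bd_inj; last by rewrite de de'.
    by apply: Pinj; congr pair => //; congr (_%:R)%R; apply: near_nat E2.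
Qed.

(** * Values of cycles *)

Lemma steps_fpath (T : eqType) (f : T -> T) (x : T) (q : seq T) :
  fpath f x q -> steps x q = [seq (y, f y) | y <- belast x q].
Proof. by elim: q x => [|y q IHq] x //= /andP[/eqP<- /IHq->]. Qed.

Lemma steps_next (T : eqType) (x : T) (p : seq T) : uniq (x :: p) ->
  steps x (rcons p x) = [seq (y, next (x :: p) y) | y <- x :: p].
Proof. by move=> /cycle_next /steps_fpath; rewrite belast_rcons. Qed.

(** Two vertices that succeed each other would form a closed walk of length two, whose two steps use
    the same edge. Excluding this makes edges of a cycle correspond to its vertices. *)
Lemma next_pair_inj (T : eqType) (c : seq T) (x y : T) : uniq c -> 2 < size c ->
  x \in c -> x = next c y -> y = next c x -> x = y.
Proof.
move=> Uc c2 xc ex ey; have [i q rotc] := rot_to xc.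
move: c2 (Uc) ex ey; rewrite -(next_rot i Uc y) -(next_rot i Uc x).
rewrite -(size_rot i) -(rot_uniq i) rotc.
case: q {rotc} => [|a [|b q]] //= _ /and4P[]; rewrite !inE !negb_or.
move=> /and3P[xa xb _] /andP[ab _] _ _ + ya.
by rewrite ya eqxx eq_sym (negPf xa) eqxx => E; rewrite E eqxx in xb.
Qed.

Lemma set2_eq (T : finType) (x y a b : T) : [set x; y]%SET = [set a; b]%SET ->
  a = x /\ b = y \/ a = y /\ b = x.
Proof.
move=> E; have := set21 x y; have := set22 x y; have := set21 a b; have := set22 a b.
by rewrite E -{1 2}E !inE => /orP[]/eqP-> /orP[]/eqP->; rewrite ?orbb;
  move=> /eqP E1 /eqP E2; subst; auto.
Qed.

(** The order of the ends picked is immaterial for symmetric [f]. The default 0 never occurs, since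
    every edge is a pair. *)
Definition sym_labelling (G : sgraph) (Gamma : zmodType) (f : G -> G -> Gamma) :
    labelling G Gamma := fun e =>
  if [pick p : G * G | val e == [set p.1; p.2]%SET] is Some p then f p.1 p.2 else 0%R.

Lemma value_cycle (G : sgraph) (Gamma : zmodType) (f : G -> G -> Gamma)
    (H : subgraph G) (c : seq G) :
  (forall x y, f x y = f y x) -> uniq c -> 2 < size c ->
  subE H = [set [set x; next c x] | x in c]%SET ->
  value (sym_labelling f) H = (\sum_(x <- c) f x (next c x))%R.
Proof.
move=> fC Uc c2 eH.
(* [F] extends the labelling to all vertex sets, which turns the sum over the edge subtype into a
   sum over [subE H]. *)
pose F (B : {set G}) : Gamma :=
  if [pick p : G * G | B == [set p.1; p.2]%SET] is Some p then f p.1 p.2 else 0%R.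
have FE x y : F [set x; y]%SET = f x y.
  rewrite /F; case: pickP => [[a b] /= /eqP/set2_eq|/(_ (x, y))]; last by rewrite eqxx.
  by case=> -[-> ->].
rewrite /value -(big_sub_cond (edge_set G) (fun B => B \in subE H) F).
transitivity (\sum_(B in subE H) F B)%R.
  apply: eq_bigl => B; apply: andb_idl; exact: (fintype.subsetP (subE_edges H)).
rewrite eH big_imset /=; last first.
  move=> x y xc yc /set2_eq[[->//]|[ey ex]]; symmetry.
  exact: (next_pair_inj Uc c2).
by rewrite big_uniq //=; apply: eq_bigr => x _; rewrite FE.
Qed.

(* [Z] is a set of horizontal edges, each encoded by its left end. *)
Definition hedge (Z : pred (nat * nat)) (a b : nat * nat) : bool :=
  (a.2 == b.2) && Z (minn a.1 b.1, a.2).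

Lemma hedgeC (Z : pred (nat * nat)) (a b : nat * nat) : hedge Z a b = hedge Z b a.
Proof. by rewrite /hedge minnC; case: eqVneq => // ->. Qed.

Definition hcount (Z : pred (nat * nat)) (c : seq (nat * nat)) : nat :=
  count (fun a => hedge Z a (next c a)) c.

(** Vertical edges get value 0, because [hedge] requires both ends in one row. *)
Definition grid_label (W H : nat) (Gamma : zmodType) (g1 g2 g3 : Gamma)
    (Z1 Z2 Z3 : pred (nat * nat)) : labelling (grid W H) Gamma :=
  @sym_labelling (grid W H) Gamma (fun u v => g1 *+ hedge Z1 (coord u) (coord v) +
    g2 *+ hedge Z2 (coord u) (coord v) + g3 *+ hedge Z3 (coord u) (coord v))%R.

Lemma sum_mulrb_count (T : Type) (Gamma : zmodType) (g : Gamma) (P : pred T) (s : seq T) :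
  (\sum_(x <- s) g *+ P x = g *+ count P s)%R.
Proof. by elim: s => [|x s IHs]; rewrite ?big_nil ?mulr0n // big_cons IHs mulrnDr. Qed.

Lemma value_grid_cycle (W H : nat) (Gamma : zmodType) (g1 g2 g3 : Gamma)
    (Z1 Z2 Z3 : pred (nat * nat)) (C : subgraph (grid W H)) (c : seq (grid W H)) :
  uniq c -> 2 < size c -> subE C = [set [set x; next c x] | x in c]%SET ->
  value (grid_label g1 g2 g3 Z1 Z2 Z3) C =
    (g1 *+ hcount Z1 (map (@coord W H) c) + g2 *+ hcount Z2 (map (@coord W H) c) +
     g3 *+ hcount Z3 (map (@coord W H) c))%R.
Proof.
move=> Uc c2 eC; rewrite (value_cycle _ Uc c2 eC); last first.
  by move=> x y; rewrite !(hedgeC _ (coord x)).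
have hE Z : hcount Z (map (@coord W H) c) =
    count (fun x => hedge Z (coord x) (coord (next c x))) c.
  rewrite /hcount count_map; apply: eq_count => x /=.
  by rewrite next_map //; exact: coord_inj.
by rewrite !big_split !sum_mulrb_count !hE.
Qed.

Lemma grid_cycle (W H : nat) (C : subgraph (grid W H)) : is_cycle C ->
  exists c : seq (grid W H), [/\ uniq c, 2 < size c,
    subE C = [set [set x; next c x] | x in c]%SET, cycle grid_adj (map (@coord W H) c)
    & forall v, (v \in subV C) = (coord v \in map (@coord W H) c)].
Proof.
case=> c [/andP[cc Uc] c2 VC EC]; exists c; split=> //.
  by rewrite cycle_map.
by move=> v; rewrite VC inE mem_map //; exact: coord_inj.
Qed.

(** * What the edge counts say about the position of a cycle *)

Lemma hcount_gt0 (Z : pred (nat * nat)) (c : seq (nat * nat)) :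
  cycle grid_adj c -> 0 < hcount Z c -> exists2 a, a \in c & Z a.
Proof.
move=> cc; rewrite -has_count => /hasP[a ac /andP[/eqP ea Za]].
exists (minn a.1 (next c a).1, a.2) => //; rewrite /minn; case: ltnP => _.
  by rewrite -surjective_pairing.
by rewrite ea -surjective_pairing mem_next.
Qed.

(** If [u2] lies left of [v2], then [v1], [u2], [v2], [u3] appear in this order in the top row, so a
    walk in [c] from [u2] to [u3] and one in [c'] from [v1] to [v2] interleave. The hypotheses are
    symmetric under exchanging the cycles. *)
Lemma no_disjoint_triples (c c' : seq (nat * nat)) (u1 u2 u3 v1 v2 v3 : nat * nat) :
  cycle grid_adj c -> cycle grid_adj c' -> {in c', forall v, v \notin c} ->
  {subset [:: u1; u2; u3] <= c} -> {subset [:: v1; v2; v3] <= c'} ->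
  all (fun v => v.2 == 0) [:: u1; u2; u3] -> all (fun v => v.2 == 0) [:: v1; v2; v3] ->
  u1.1 < v2.1 -> v1.1 < u2.1 -> u2.1 < v3.1 -> v2.1 < u3.1 -> False.
Proof.
wlog lt : c c' u1 u2 u3 v1 v2 v3 / u2.1 <= v2.1.
  move=> th cc cc' dis sub sub'; case/orP: (leq_total u2.1 v2.1) => le.
    exact: (th c c' u1 u2 u3 v1 v2 v3).
  move=> *; apply: (th c' c v1 v2 v3 u1 u2 u3) => //.
  by move=> v vc; apply/negP => /dis; rewrite vc.
move=> cc cc' dis sub sub' /and4P[_ /eqP u20 /eqP u30 _] /and4P[/eqP v10 /eqP v20 _ _] _ l1 _ l3.
have [u2c u3c] : u2 \in c /\ u3 \in c by split; apply: sub; rewrite !inE eqxx ?orbT.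
have [v1c v2c] : v1 \in c' /\ v2 \in c' by split; apply: sub'; rewrite !inE eqxx ?orbT.
have [p [pathp lastp subp]] := cycle_walk cc u2c u3c.
have [q [pathq lastq subq]] := cycle_walk cc' v1c v2c.
apply: (no_interleaved_walks pathp pathq); rewrite ?lastp ?lastq //.
  by move=> v /subq /dis; apply: contra => /subp.
rewrite ltn_neqAle lt andbT; apply/eqP => E.
have /negP := dis v2 v2c; apply.
by rewrite (_ : v2 = u2) //; apply/eqP; rewrite -pair_eqE /= E u20 v20 !eqxx.
Qed.

Lemma big_addb_count (T : Type) (P : pred T) (s : seq T) :
  \big[addb/false]_(x <- s) P x = odd (count P s).
Proof. by elim: s => [|x s IHs]; rewrite ?big_nil // big_cons IHs /= oddD oddb. Qed.

(** The counted edges are exactly those crossed by the ray from [(col, row)], and for a closed walk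
    the two arc terms cancel. *)
Lemma hcount_ray_parity (c : seq (nat * nat)) (x : nat * nat) (col row : nat) :
  cycle grid_adj c -> uniq c -> x \in c ->
  exists p, [/\ path grid_adj x p, last x p = x, x :: p =i c &
    ray_parity x p (col, row) = odd (hcount (fun a => (a.1 == col) && (a.2 < row)) c)].
Proof.
move=> cc Uc xc; have [i q rotc] := rot_to xc.
have Uq : uniq (x :: q) by rewrite -rotc rot_uniq.
have pathq : path grid_adj x (rcons q x) by move: cc; rewrite -(rot_cycle i) rotc.
exists (rcons q x); split=> //; first by rewrite last_rcons.
  by move=> y; rewrite -(mem_rot i c) rotc !inE mem_rcons inE; case: eqP.
rewrite /ray_parity last_rcons addbb addbF big_addb_count.
rewrite /hcount -(permP (permEl (perm_rot i c))) rotc; congr odd.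
under [RHS]eq_count do rewrite -(next_rot i Uc) rotc.
set Z := (Z in hedge Z).
have -> : count (fun a => hedge Z a (next (x :: q) a)) (x :: q) =
    count (fun u => hedge Z u.1 u.2) (steps x (rcons q x)).
  by rewrite steps_next // count_map.
apply: eq_in_count => u /(steps_mem pathq)[+ _ _].
rewrite /above /hedge /Z /grid_adj /grid_step.
case: u => [[a1 a2] [b1 b2]] /=; lia.
Qed.

(** * Skyline cycles *)

(** Lets cycles be built from pairs of natural numbers, with bounds checked only at the end. *)
Lemma lift_cycle (W H : nat) (c : seq (nat * nat)) :
  cycle grid_adj c -> uniq c -> 2 < size c ->
  {in c, forall a, (a.1 <= W) && (a.2 <= H)} ->
  exists C : subgraph (grid W.+1 H.+1), [/\ is_cycle C,
    forall v, v \in subV C -> coord v \in c &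
    forall (Gamma : zmodType) (g1 g2 g3 : Gamma) Z1 Z2 Z3,
      value (grid_label g1 g2 g3 Z1 Z2 Z3) C =
        (g1 *+ hcount Z1 c + g2 *+ hcount Z2 c + g3 *+ hcount Z3 c)%R].
Proof.
move=> cc Uc c2 bound.
pose c0 : seq (grid W.+1 H.+1) := [seq (inord a.1, inord a.2) | a <- c].
have coord_c0 : map (@coord _ _) c0 = c.
  rewrite -map_comp map_id_in // => a /bound/andP[a1 a2].
  by rewrite /coord /= !inordK //; case: (a).
have Uc0 : uniq c0 by rewrite -(map_inj_uniq (@coord_inj _ _)) coord_c0.
have cc0 : cycle (@adj (grid W.+1 H.+1)) c0.
  by rewrite -[c]coord_c0 cycle_map in cc.
have E1 : [set [set x; next c0 x] | x in c0]%SET \subset edge_set (grid W.+1 H.+1).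
  apply/fintype.subsetP => e /imsetP[x xc ->].
  apply/imsetP; exists (x, next c0 x) => //; rewrite inE /=.
  exact: (next_cycle cc0 xc).
have E2 (e : {set grid W.+1 H.+1}) : e \in [set [set x; next c0 x] | x in c0]%SET ->
    e \subset [set x in c0]%SET.
  move=> /imsetP[x xc ->]; apply/fintype.subsetP => y.
  by rewrite !inE => /orP[]/eqP-> //; rewrite mem_next.
exists (Subgraph E1 E2); split.
- by exists c0; split; rewrite // ?size_map // /ucycle cc0.
- by move=> v; rewrite inE => vc; rewrite -coord_c0 map_f.
- move=> Gamma g1 g2 g3 Z1 Z2 Z3.
  by rewrite (value_grid_cycle _ _ _ _ _ _ Uc0) ?size_map // coord_c0.
Qed.

(** In [vdown], [hleft], [vpath] and [skyline] the starting point is left out, to match the second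
    argument of [path]. Here the row index decreases from [y + n] to [y]. *)
Fixpoint vdown (x y n : nat) : seq (nat * nat) :=
  if n is m.+1 then (x, y + m) :: vdown x y m else [::].

Fixpoint hleft (x y n : nat) : seq (nat * nat) :=
  if n is m.+1 then (x + m, y) :: hleft x y m else [::].

Definition vpath (x y z : nat) : seq (nat * nat) :=
  if y <= z then [seq (x, i) | i <- iota y.+1 (z - y)] else vdown x z (y - z).

Lemma mem_vdown (x y n : nat) (a : nat * nat) :
  (a \in vdown x y n) = (a.1 == x) && (y <= a.2 < y + n).
Proof.
elim: n => [|n IHn] /=; first by rewrite in_nil; lia.
by rewrite in_cons IHn -pair_eqE /=; lia.
Qed.

Lemma mem_hleft (x y n : nat) (a : nat * nat) :
  (a \in hleft x y n) = (a.2 == y) && (x <= a.1 < x + n).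
Proof.
elim: n => [|n IHn] /=; first by rewrite in_nil; lia.
by rewrite in_cons IHn -pair_eqE /=; lia.
Qed.

Lemma hleft_uniq (x y n : nat) : uniq (hleft x y n).
Proof. by elim: n => //= n ->; rewrite mem_hleft /=; lia. Qed.

Lemma hleft_path (x y n : nat) : path grid_adj (x + n, y) (hleft x y n).
Proof. by elim: n => //= n ->; rewrite /grid_adj /grid_step /=; lia. Qed.

Lemma hleft_rcons (x y n : nat) : hleft x y n.+1 = rcons (hleft x.+1 y n) (x, y).
Proof.
elim: n => [|n IHn]; first by rewrite /= addn0.
by rewrite [LHS]/= -/(hleft x y n.+1) IHn /= addSnnS.
Qed.

Lemma mem_vpath (x y z : nat) (a : nat * nat) :
  (a \in vpath x y z) = [&& a.1 == x, a.2 != y & minn y z <= a.2 <= maxn y z].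
Proof.
rewrite /vpath; case: leqP => yz; last by rewrite mem_vdown; lia.
case: a => i j; apply/mapP/idP => /= [[k]|].
  by rewrite mem_iota => ? [-> ->]; lia.
by move=> ij; exists j; rewrite ?mem_iota; [lia | congr pair; lia].
Qed.

Lemma vpath_uniq (x y z : nat) : uniq (vpath x y z).
Proof.
rewrite /vpath; case: leqP => yz; first by rewrite map_inj_uniq ?iota_uniq // => i j [].
by elim: (y - z) => //= n ->; rewrite mem_vdown /=; lia.
Qed.

Lemma vpath_path (x y z : nat) : path grid_adj (x, y) (vpath x y z).
Proof.
rewrite /vpath; case: leqP => yz.
  move: (z - y) {yz} => m; elim: m y => //= n IHn y.
  by rewrite IHn /grid_adj /grid_step /= !eqxx orbT.
rewrite [y in (x, y)](_ : y = z + (y - z)); last by lia.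
by elim: (y - z) => //= n ->; rewrite /grid_adj /grid_step /=; lia.
Qed.

Lemma vpath_last (x y z : nat) : last (x, y) (vpath x y z) = (x, z).
Proof.
rewrite /vpath; case: leqP => yz.
  have {2}-> : z = y + (z - y) by lia.
  by move: (z - y) {yz} => m; elim: m y => [|n IHn] y /=; [rewrite addn0 | rewrite IHn addSnnS].
rewrite [y in (x, y)](_ : y = z + (y - z)); last by lia.
by elim: (y - z) => [|n IHn] /=; first by rewrite addn0.
Qed.

(* The path from [(x, y)] to [(x + n, z)] that crosses from column [i] to column
   [i + 1] in row [h i] and moves vertically otherwise. *)
Fixpoint skyline (h : nat -> nat) (x y n z : nat) : seq (nat * nat) :=
  if n is m.+1 then vpath x y (h x) ++ (x.+1, h x) :: skyline h x.+1 (h x) m z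
  else vpath x y z.

Lemma skylineS (h : nat -> nat) (x y n z : nat) : skyline h x y n.+1 z =
  vpath x y (h x) ++ (x.+1, h x) :: skyline h x.+1 (h x) n z.
Proof. by []. Qed.

Arguments skyline : simpl never.

Lemma skyline_path (h : nat -> nat) (x y n z : nat) :
  path grid_adj (x, y) (skyline h x y n z).
Proof.
elim: n x y => [|n IHn] x y; first exact: vpath_path.
rewrite skylineS cat_path vpath_path vpath_last /= IHn andbT.
by rewrite /grid_adj /grid_step /= !eqxx.
Qed.

Lemma skyline_last (h : nat -> nat) (x y n z : nat) :
  last (x, y) (skyline h x y n z) = (x + n, z).
Proof.
elim: n x y => [|n IHn] x y; first by rewrite vpath_last addn0.
by rewrite skylineS last_cat /= IHn addSnnS.
Qed.

(** [r] is the row in which the path enters the column of [a] and [s] the row in which it leaves; in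
    between it moves monotonically. *)
Lemma skyline_mem (h : nat -> nat) (x y n z : nat) (a : nat * nat)
    (r := if a.1 == x then y else h a.1.-1) (s := if a.1 == x + n then z else h a.1) :
  a \in skyline h x y n z -> (x <= a.1 <= x + n) && (minn r s <= a.2 <= maxn r s).
Proof.
rewrite /r /s {r s}; elim: n x y => [|n IHn] x y.
  by rewrite mem_vpath => /and3P[/eqP-> _]; rewrite addn0 eqxx leqnn.
rewrite skylineS mem_cat in_cons => /or3P[].
- rewrite mem_vpath => /and3P[/eqP-> _]; rewrite eqxx.
  by case: eqVneq => [|_]; lia.
- by move=> /eqP-> /=; rewrite (_ : (x.+1 == x) = false); [case: eqVneq => _; lia | lia].
- move/IHn; rewrite addSnnS; case: (eqVneq a.1 x.+1) => [->|n1] /=;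
    case: eqVneq => _; case: eqVneq => ?; lia.
Qed.

(** Columns are visited from left to right, and within a column the path is monotone. *)
Lemma skyline_uniq (h : nat -> nat) (x y n z : nat) : uniq ((x, y) :: skyline h x y n z).
Proof.
elim: n x y => [|n IHn] x y; rewrite cons_uniq.
  by rewrite /= vpath_uniq mem_vpath /= !eqxx.
have right a : a \in (x.+1, h x) :: skyline h x.+1 (h x) n z -> x < a.1.
  by rewrite in_cons => /predU1P[->//|/skyline_mem /andP[/andP[]]].
rewrite skylineS mem_cat cat_uniq vpath_uniq IHn mem_vpath !eqxx andbF andbT.
apply/andP; split; first by apply/negP => /right; rewrite ltnn.
apply/hasPn => a /right xa; rewrite mem_vpath negb_and; by rewrite neq_ltn xa orbT.
Qed.

Lemma vpath_count (Z : pred (nat * nat)) (x y z : nat) :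
  count (fun u => hedge Z u.1 u.2) (steps (x, y) (vpath x y z)) = 0.
Proof.
apply/eqP; rewrite -leqn0 leqNgt -has_count; apply/hasPn => u.
move=> /(steps_mem (vpath_path x y z))[uu u1 u2].
have col a : a \in (x, y) :: vpath x y z -> a.1 = x.
  by rewrite in_cons mem_vpath => /predU1P[->|/andP[/eqP]].
rewrite /hedge; move: uu; rewrite /grid_adj /grid_step (col _ u1) (col _ u2).
by case: (Z _); case: u {u1 u2} => [[a1 a2] [b1 b2]] /=; lia.
Qed.

Lemma skyline_count (Z : pred (nat * nat)) (h : nat -> nat) (x y n z : nat) :
  count (fun u => hedge Z u.1 u.2) (steps (x, y) (skyline h x y n z)) =
  count (fun i => Z (i, h i)) (iota x n).
Proof.
elim: n x y => [|n IHn] x y; first exact: vpath_count.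
rewrite skylineS steps_cat count_cat vpath_count vpath_last /= IHn.
by rewrite /hedge /= eqxx (minn_idPl (leqnSn x)).
Qed.

(** The skyline from [(a, z)] to [(a + n, z)] is closed by walking back along row [z]. All crossings
    lie strictly above that row, so the two parts meet only at their ends. *)
Lemma skyline_cycle (h : nat -> nat) (a n z : nat)
    (r := fun i => if i == a then z else h i.-1)
    (s := fun i => if i == a + n then z else h i) :
  0 < n -> (forall i, h i < z) ->
  exists c, [/\ cycle grid_adj c, uniq c, 2 < size c,
    {in c, forall v, (a <= v.1 <= a + n) &&
       ((v.2 == z) || (minn (r v.1) (s v.1) <= v.2 <= maxn (r v.1) (s v.1)))} &
    forall Z : pred (nat * nat), (forall i, ~~ Z (i, z)) ->
      hcount Z c = count (fun i => Z (i, h i)) (iota a n)].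
Proof.
case: n @s => // n s _ hz.
(* The way back stops in column [a + 1], so that [(a, z)] is listed only once. *)
pose p := skyline h a z n.+1 z ++ hleft a.+1 z n.
have lastp : last (a, z) (skyline h a z n.+1 z) = (a + n.+1, z) by rewrite skyline_last.
have rp : rcons p (a, z) = skyline h a z n.+1 z ++ hleft a z n.+1.
  by rewrite hleft_rcons rcons_cat.
have Up : uniq ((a, z) :: p).
  rewrite -cat_cons cat_uniq skyline_uniq hleft_uniq andbT andTb.
  apply/hasPn => -[i j]; rewrite mem_hleft => /andP[/= /eqP-> ai]; apply/negP.
  rewrite in_cons => /predU1P[[E]|]; first by move: ai; rewrite E ltnn.
  move/skyline_mem => /=; rewrite !ifF; [|lia|lia].
  have := hz i; have := hz i.-1; lia.
exists ((a, z) :: p); split=> //.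
- by rewrite /= rp cat_path skyline_path lastp hleft_path.
- rewrite /p /= size_cat size_cat /=.
  suff : 0 < size (vpath a z (h a)) by lia.
  have := vpath_last a z (h a); case: (vpath _ _ _) => //= -[E].
  by have := hz a; rewrite -E ltnn.
- move=> v; rewrite in_cons mem_cat => /or3P[/eqP->|/skyline_mem|].
  + by rewrite !eqxx leqnn leq_addr.
  + by move=> /andP[-> ->]; rewrite orbT.
  + rewrite mem_hleft => /andP[-> /andP[l1 l2]].
    by rewrite (ltnW l1) -addSnnS (ltnW l2).
- move=> Z Zz; rewrite /hcount.
  have -> : count (fun v => hedge Z v (next ((a, z) :: p) v)) ((a, z) :: p) =
      count (fun u => hedge Z u.1 u.2) (steps (a, z) (rcons p (a, z))).
    by rewrite steps_next // count_map.
  rewrite rp steps_cat count_cat skyline_count lastp.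
  rewrite [X in _ + X](_ : _ = 0) ?addn0 //.
  apply/eqP; rewrite -leqn0 leqNgt -has_count; apply/hasPn => u.
  move=> /(steps_mem (hleft_path a z n.+1))[_ u1 _].
  rewrite /hedge; have -> : u.1.2 = z.
    by move: u1; rewrite in_cons mem_hleft => /predU1P[->|/andP[/eqP]].
  by rewrite (negPf (Zz _)) andbF.
Qed.

(** * The two constructions *)

(** The skyline runs in row [k] and rises to row 0 for each crossing in [D], so it uses only rows
    [k] and [z], the two columns of each prong and the last column [b]. The first column is covered
    by [D a]. *)
Lemma pronged_cycle (D : pred nat) (k z a b : nat) (ok : pred (nat * nat)) :
  k < z -> a < b -> D a ->
  (forall i, ok (i, k)) -> (forall i, ok (i, z)) -> (forall j, ok (b, j)) ->
  (forall i j, D i -> ok (i, j) && ok (i.+1, j)) ->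
  exists c, [/\ cycle grid_adj c, uniq c, 2 < size c,
    {in c, forall v, [&& v.1 <= b, v.2 <= z & ok v]} &
    forall Z : pred (nat * nat), (forall i, ~~ Z (i, z)) ->
      hcount Z c = count (fun i => Z (i, if D i then 0 else k)) (iota a (b - a))].
Proof.
move=> kz ab Da okk okz okb okD; pose h i := if D i then 0 else k.
have hk i : h i <= k by rewrite /h; case: ifP.
have hz i : h i < z by exact: leq_ltn_trans (hk i) kz.
have n0 : 0 < b - a by rewrite subn_gt0.
have [c [cc Uc c2 cP Zc]] := skyline_cycle a n0 hz.
exists c; split=> // -[i j] /cP /=; rewrite subnKC ?(ltnW ab) //.
case/andP=> /andP[ai ib]; rewrite ib /= => /orP[/eqP->|jP]; first by rewrite leqnn okz.
have jz : j <= z.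
  move: jP; case: ifP => _; case: ifP => _; have := hz i; have := hz i.-1; lia.
rewrite jz /=; have [->|ia] := eqVneq i a; first by case/andP: (okD a j Da).
have [->|nb] := eqVneq i b; first exact: okb.
have i1 : i = i.-1.+1 by lia.
move: jP; rewrite (negPf ia) (negPf nb) /h.
case Di: (D i); first by case/andP: (okD i j Di).
case Di1: (D i.-1); first by case/andP: (okD i.-1 j Di1); rewrite -i1.
by rewrite minnn maxnn -eqn_leq => /eqP<-.
Qed.

(** Pigeonhole: at most [t] vertices cannot meet all of [t + 1] classes. The classes will be rows,
    columns and pairs of adjacent columns. *)
Lemma avoid_class (T : finType) (S : {set T}) (t : nat) (f : T -> nat) : #|S| <= t ->
  exists2 i, i <= t & forall v, v \in S -> f v != i.
Proof.
move=> St; have [|no] := pselect (exists2 i, i <= t & i \notin [seq f v | v <- enum S]).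
  case=> i it iS; exists i => // v vS; apply: contra iS => /eqP<-.
  by rewrite map_f // mem_enum.
have : size (iota 0 t.+1) <= size [seq f v | v <- enum S].
  apply: uniq_leq_size; first exact: iota_uniq.
  move=> i; rewrite mem_iota ltnS => it; apply/negPn/negP => iS.
  by apply: no; exists i.
by rewrite size_iota size_map -cardE leqNgt ltnS St.
Qed.

Lemma count_iota_eq (P : pred nat) (a n i : nat) :
  a <= i < a + n -> (forall j, a <= j < a + n -> P j = (j == i)) -> count P (iota a n) = 1.
Proof.
move=> ai Pi; rewrite (@eq_in_count _ _ (pred1 i)); last first.
  by move=> j; rewrite mem_iota => /Pi.
by rewrite count_uniq_mem ?iota_uniq // mem_iota ai.
Qed.

Lemma notin_coord (W H : nat) (S : {set grid W H}) (P : pred (nat * nat)) (a : nat * nat) :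
  (forall v, v \in S -> P (coord v)) -> ~~ P a -> a \notin map (@coord _ _) (enum S).
Proof.
move=> SP; apply: contra => /mapP[v vS ->]; apply: SP.
by rewrite mem_enum in vS.
Qed.

(** Already two disjoint cycles are excluded, which is stronger than excluding three. *)
Definition obstruction (R : realType) (Gamma : zmodType) (A : set Gamma) (t : nat) : Prop :=
  exists (G : sgraph) (gamma : labelling G Gamma),
    [/\ planar R G,
        ~ (exists C1 C2 : subgraph G,
             [/\ cycles_in gamma A C1, cycles_in gamma A C2 & vertex_disjoint C1 C2])
      & ~ (exists S : {set G}, hitting_set (cycles_in gamma A) S /\ #|S| <= t)].

Section Construction.
Variables (R : realType) (Gamma : zmodType) (A : set Gamma) (t : nat).

Lemma grid_obstruction (W H : nat) (g1 g2 g3 : Gamma) (Z1 Z2 Z3 : pred (nat * nat)) :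
  (forall c c' : seq (nat * nat), cycle grid_adj c -> cycle grid_adj c' ->
     uniq c -> uniq c' -> {in c', forall v, v \notin c} ->
     A (g1 *+ hcount Z1 c + g2 *+ hcount Z2 c + g3 *+ hcount Z3 c)%R ->
     A (g1 *+ hcount Z1 c' + g2 *+ hcount Z2 c' + g3 *+ hcount Z3 c')%R -> False) ->
  (forall S : {set grid W.+1 H.+1}, #|S| <= t ->
     exists c : seq (nat * nat), [/\ cycle grid_adj c, uniq c, 2 < size c,
       {in c, forall a, [&& a.1 <= W, a.2 <= H & a \notin map (@coord _ _) (enum S)]} &
       A (g1 *+ hcount Z1 c + g2 *+ hcount Z2 c + g3 *+ hcount Z3 c)%R]) ->
  obstruction R A t.
Proof.
move=> nodis ex; exists (grid W.+1 H.+1), (grid_label g1 g2 g3 Z1 Z2 Z3); split.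
- exact: grid_planar.
- move=> [C [C' [[/grid_cycle[c [Uc c2 EC cc VC]] AC] [cycC' AC'] dis]]].
  have [c' [Uc' c2' EC' cc' VC']] := grid_cycle cycC'.
  move: AC AC'; rewrite (value_grid_cycle _ _ _ _ _ _ Uc c2 EC).
  rewrite (value_grid_cycle _ _ _ _ _ _ Uc' c2' EC').
  apply: nodis => //; rewrite ?map_inj_uniq //; try exact: coord_inj.
  move=> _ /mapP[v vc' ->]; apply/negP; rewrite -VC => vC.
  have : v \in (subV C :&: subV C')%SET by rewrite inE vC VC' map_f.
  by rewrite dis inE.
- move=> [S [hitS /ex[c [cc Uc c2 cP Ac]]]].
  have [|C [isC VC val]] := lift_cycle (W := W) (H := H) cc Uc c2.
    by move=> a /cP/and3P[-> ->].
  have [|v vS /VC /cP/and3P[_ _ /negP]] := hitS C; first by split; rewrite ?val.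
  by apply; rewrite map_f // mem_enum.
Qed.

Lemma nested_obstruction (g h : Gamma) : A (g + h)%R ->
  (forall p q : nat, A (g *+ p + h *+ q)%R -> odd p && (0 < q)) ->
  obstruction R A t.
Proof.
(* Columns 0 to [m] form [t + 1] pairs for the prong, and [t + 1] columns remain to the right. Rows
   1 to [t + 1] are available above the inner face and [t + 1] rows below it. *)
move=> Ag need; pose m := t.*2.+1.
pose Z1 (a : nat * nat) := (a.1 == m) && (a.2 < t.+2).
pose Z2 (a : nat * nat) := (a.2 == 0) && (a.1 < m).
apply: (@grid_obstruction (m.+1 + t) t.*2.+2 g h 0%R Z1 Z2 xpred0).
(* A positive coefficient of [h] gives a starting vertex in the top row; an odd coefficient of [g]
   says that the cycle winds around the inner face. *)
- have walk c : cycle grid_adj c -> uniq c ->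
      A (g *+ hcount Z1 c + h *+ hcount Z2 c + 0 *+ hcount xpred0 c)%R ->
      exists x p, [/\ path grid_adj x p, x.2 = 0, last x p = x, x :: p =i c
        & ray_parity x p (m, t.+2)].
    move=> cc Uc; rewrite mul0rn addr0 => /need/andP[odd1].
    move=> /(hcount_gt0 cc)[x xc /andP[/eqP x0 _]].
    have [p [pathp lastp pc par]] := hcount_ray_parity m t.+2 cc Uc xc.
    by exists x, p; split=> //; rewrite par.
  move=> c c' cc cc' Uc Uc' dis /(walk c cc Uc)[x [p [pathp x0 lastp pc parp]]].
  move=> /(walk c' cc' Uc')[y [q [pathq y0 lastq qc parq]]].
  apply: (no_nested_closed_walks pathp pathq x0 y0 lastp lastq _ parp parq).
  by move=> v; rewrite pc qc; exact: dis.
- move=> S St.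
  (* Truncated subtraction and halving only enlarge class 0, so avoiding a class still avoids the
     intended row or columns. *)
  have [i it oki] := avoid_class (fun v => (coord v).1./2) St.
  have [j jt okj] := avoid_class (fun v => (coord v).1 - m.+1) St.
  have [k kt okk] := avoid_class (fun v => (coord v).2.-1) St.
  have [z zt okz] := avoid_class (fun v => (coord v).2 - t.+2) St.
  have [||||l|l l' /eqP->|c [cc Uc c2 cP Zc]] :=
    @pronged_cycle (pred1 i.*2) k.+1 (z + t.+2) i.*2 (j + m.+1)
      (fun a => a \notin map (@coord _ _) (enum S)) _ _ (eqxx _).
  + lia.
  + rewrite /m; lia.
  + by move=> l; apply: (notin_coord (P := fun a => a.2.-1 != k)) => //=; rewrite negbK.
  + by move=> l; apply: (notin_coord (P := fun a => a.2 - t.+2 != z)) => //=; rewrite negbK addnK.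
  + by apply: (notin_coord (P := fun a => a.1 - m.+1 != j)) => //=; rewrite negbK addnK.
  + by rewrite !(notin_coord (P := fun a => a.1./2 != i)) //=; lia.
  exists c; split=> //.
    move=> v /cP/and3P[v1 v2 ->]; rewrite andbT; apply/andP; split.
      by apply: (leq_trans v1); rewrite addnC leq_add2l.
    by apply: (leq_trans v2); lia.
  (* The cycle meets [Z1] only where row [k + 1] crosses from column [m], and [Z2] only at the tip
     of its prong, so its value is [g + h]. *)
  have count1 (Z : pred (nat * nat)) l : (forall l', ~~ Z (l', z + t.+2)) ->
      i.*2 <= l < j + m.+1 -> (forall l', Z (l', if l' == i.*2 then 0 else k.+1) = (l' == l)) ->
      hcount Z c = 1.
    by move=> Zz li Zl; rewrite Zc // (@count_iota_eq _ _ _ l) // subnKC //; lia.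
  rewrite (count1 Z1 m) ?(count1 Z2 i.*2) ?mul0rn ?addr0 //.
  all: rewrite /m; try lia.
  all: move=> l; rewrite /Z1 /Z2 /= /m; try case: ifP; lia.
Qed.

Lemma triple_obstruction (g1 g2 g3 : Gamma) : A (g1 + g2 + g3)%R ->
  (forall p q r : nat, A (g1 *+ p + g2 *+ q + g3 *+ r)%R -> [&& 0 < p, 0 < q & 0 < r]) ->
  obstruction R A t.
Proof.
(* Each of the three segments of the top row has [n] columns, that is, [t + 1] disjoint pairs of
   adjacent columns for a prong. *)
move=> Ag need; pose n := t.*2.+2.
pose Z1 (a : nat * nat) := (a.2 == 0) && (a.1 < n).
pose Z2 (a : nat * nat) := (a.2 == 0) && (n <= a.1 < n.*2).
pose Z3 (a : nat * nat) := (a.2 == 0) && (n.*2 <= a.1).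
apply: (@grid_obstruction (n.*2 + n) t.*2.+2 g1 g2 g3 Z1 Z2 Z3).
- have tops c : cycle grid_adj c ->
      A (g1 *+ hcount Z1 c + g2 *+ hcount Z2 c + g3 *+ hcount Z3 c)%R ->
      exists u1 u2 u3, [/\ {subset [:: u1; u2; u3] <= c},
        all (fun v => v.2 == 0) [:: u1; u2; u3] & [/\ u1.1 < n, n <= u2.1 < n.*2 & n.*2 <= u3.1]].
    move=> cc /need/and3P[] /(hcount_gt0 cc)[u1 u1c /andP[u10 u1n]].
    move=> /(hcount_gt0 cc)[u2 u2c /andP[u20 u2n]].
    move=> /(hcount_gt0 cc)[u3 u3c /andP[u30 u3n]].
    exists u1, u2, u3; split=> //; last by rewrite /= u10 u20 u30.
    by move=> u; rewrite !inE => /or3P[]/eqP->.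
  move=> c c' cc cc' _ _ dis /(tops c cc)[u1 [u2 [u3 [su u0 [u1n /andP[u2n u2n'] u3n]]]]].
  move=> /(tops c' cc')[v1 [v2 [v3 [sv v0 [v1n /andP[v2n v2n'] v3n]]]]].
  apply: (no_disjoint_triples cc cc' dis su sv u0 v0).
  + exact: leq_trans v2n.
  + exact: leq_trans u2n.
  + exact: leq_trans v3n.
  + exact: leq_trans u3n.
- move=> S St.
  have [i1 i1t ok1] := avoid_class (fun v => (coord v).1./2) St.
  have [i2 i2t ok2] := avoid_class (fun v => ((coord v).1 - n)./2) St.
  have [i3 i3t ok3] := avoid_class (fun v => ((coord v).1 - n.*2)./2) St.
  have [k kt okk] := avoid_class (fun v => (coord v).2.-1) St.
  have [z zt okz] := avoid_class (fun v => (coord v).2 - t.+2) St.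
  (* One prong per segment gives each label exactly once. The cycle ends in column [a3 + 1], the
     second column of the last prong, which avoids [S]. *)
  pose a1 := i1.*2; pose a2 := n + i2.*2; pose a3 := n.*2 + i3.*2.
  pose D i := [|| i == a1, i == a2 | i == a3].
  have okD i j : D i -> ((i, j) \notin map (@coord _ _) (enum S)) &&
      ((i.+1, j) \notin map (@coord _ _) (enum S)).
    case/or3P=> /eqP->;
      [ have E := notin_coord (P := fun a => a.1./2 != i1) ok1
      | have E := notin_coord (P := fun a => (a.1 - n)./2 != i2) ok2
      | have E := notin_coord (P := fun a => (a.1 - n.*2)./2 != i3) ok3 ];
      rewrite !E //= negbK; apply/eqP; rewrite /a1 /a2 /a3; lia.
  have [|||||j|c [cc Uc c2 cP Zc]] := @pronged_cycle D k.+1 (z + t.+2) a1 a3.+1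
    (fun a => a \notin map (@coord _ _) (enum S)) _ _ _ _ _ _ okD.
  + lia.
  + rewrite /a1 /a3; lia.
  + by rewrite /D eqxx.
  + by move=> i; apply: (notin_coord (P := fun a => a.2.-1 != k)) => //=; rewrite negbK.
  + by move=> i; apply: (notin_coord (P := fun a => a.2 - t.+2 != z)) => //=; rewrite negbK addnK.
  + have /(okD a3 j)/andP[] // : D a3 by rewrite /D eqxx !orbT.
  exists c; split=> //.
    move=> v /cP/and3P[v1 v2 ->]; rewrite andbT; apply/andP; split.
      by apply: (leq_trans v1); rewrite /a3 /n; lia.
    by apply: (leq_trans v2); lia.
  have count1 (Z : pred (nat * nat)) i : (forall j, ~~ Z (j, z + t.+2)) ->
      a1 <= i <= a3 -> (forall j, Z (j, if D j then 0 else k.+1) = (j == i)) ->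
      hcount Z c = 1.
    by move=> Zz ia Zi; rewrite Zc // (@count_iota_eq _ _ _ i) //; lia.
  rewrite (count1 Z1 a1) ?(count1 Z2 a2) ?(count1 Z3 a3) //.
  all: try by move=> j; rewrite /Z1 /Z2 /Z3 /= addnS.
  all: rewrite /a1 /a2 /a3; try lia.
  all: move=> j; rewrite /Z1 /Z2 /Z3 /D /=; case: ifP; rewrite /a1 /a2 /a3 /n; lia.
Qed.

End Construction.

(** * From the failure of the condition to the two constructions *)

Theorem corollary8p7 (R : realType) (Gamma : zmodType) (A : set Gamma)
    (hA : ~ two_subset_condition A) (t : nat) (ht : (0 < t)%N) :
  exists (G : sgraph) (gamma : labelling G Gamma),
    [/\ planar R G,
        ~ (exists C1 C2 C3 : subgraph G,
             [/\ cycles_in gamma A C1, cycles_in gamma A C2,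
                 cycles_in gamma A C3 &
                 [/\ vertex_disjoint C1 C2, vertex_disjoint C1 C3
                   & vertex_disjoint C2 C3]])
      & ~ (exists S : {set G},
             hitting_set (cycles_in gamma A) S /\ (#|S| <= t)%N)].
Proof.
have [X [AX bad]] : exists X : {fset Gamma}, A (\sum_(g <- X) g)%R /\
    forall Y : {fset Gamma}, (Y `<=` X)%fset -> #|` Y| <= 2 ->
      ~ (subgroup_gen (card_scale Y) `&` A !=set0)%classic.
  apply: contrapT => no; apply: hA => X AX; apply: contrapT => noY; apply: no.
  by exists X; split=> // Y YX Y2 YA; apply: noY; exists Y.
suff [G [gamma [pG dis hit]]] : obstruction R A t.
  exists G, gamma; split=> // -[C1 [C2 [C3 [OC1 OC2 _ [C12 _ _]]]]].
  by apply: dis; exists C1, C2.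
have [[g [h [Agh need]]]|[g1 [g2 [g3 [Ag need]]]]] := nested_or_triple bad AX.
  exact: nested_obstruction Agh need.
exact: triple_obstruction Ag need.
Qed.
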